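(* Let $n \ge 3$ and let $\mu$ be a probability distribution on the braid group $\mathfrak{B}_n$ which induces the uniform distribution on the symmetric group $\mathfrak{S}_n$ via the natural projection $\pi : \mathfrak{B}_n \to \mathfrak{S}_n$ (in the sense defined in the context). Consider the random braid obtained from the random walk on $\mathfrak{B}_n$ defined by $\mu$. Then the most expected partition of the number of strings is $((n-1), 1)$.
   Context: $\mathfrak{B}_n$ is the braid group on $n$ strings, with canonical generators $\sigma_1,\dots,\sigma_{n-1}$; $\mathfrak{S}_n$ is the symmetric group on $n$ letters; $\pi : \mathfrak{B}_n \to \mathfrak{S}_n$ is the natural projection sending a braid to the permutation of its strings (so $\sigma_i \mapsto (i\ \, i+1)$). Random walk: a probability distribution $\mu$ on $\mathfrak{B}_n$ defines a random walk on $\mathfrak{B}_n$ with transition probability $\mathbb{P}(x,y) = \mu(xy^{-1})$, starting at the identity element at time zero. Let $\omega_{n,k}$ denote the (random) position of this walk after $k$ steps. Then $\pi(\omega_{n,k})$ is the induced random walk on $\mathfrak{S}_n$. ''$\mu$ induces the uniform distribution on $\mathfrak{S}_n$ via $\pi$'' means that for every $s \in \mathfrak{S}_n$, the probability that $\pi(\omega_{n,k}) = s$ converges to $1/n!$ as $k \to \infty$. Partition of the number of strings: for a braid $\sigma \in \mathfrak{B}_n$, write $\pi(\sigma)$ as a product of cycles on mutually distinct letters (including cycles of length 1 for fixed letters), with lengths $n_1 \ge n_2 \ge \cdots \ge n_m \ge 1$, $n_1 + \cdots + n_m = n$. The partition of the number of strings for $\sigma$ is the non-increasing sequence $(n_1,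 n_2, \dots, n_m)$. The most expected partition of the number of strings is said to be a partition $\lambda$ of $n$ if, for every sufficiently large $k$, the probability that the partition of the number of strings for $\omega_{n,k}$ is $\lambda$ is maximal among the corresponding probabilities for all partitions of $n$. *)

(* Defs.v *)
From HB Require Import structures.
From mathcomp Require Import all_boot all_order all_algebra all_fingroup.
From mathcomp Require Import generic_quotient.
From mathcomp Require Import zify.
From mathcomp Require Import all_classical all_reals all_analysis.

Set Implicit Arguments.
Unset Strict Implicit.
Unset Printing Implicit Defensive.

Import Order.TTheory GRing.Theory Num.Theory.
Import numFieldNormedType.Exports.

Local Open Scope classical_set_scope.
Local Open Scope ring_scope.

(* The braid group on [n] strings is given by the Artin presentation. The
   generators are indexed from 0, so the index [i : 'I_n.-1] stands for the
   generator usually written sigma_(i+1). A letter [(i, false)] is a generator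
   and [(i, true)] is its formal inverse. *)
Definition braid_letter (n : nat) : Type := ('I_n.-1 * bool)%type.
Definition braid_word (n : nat) : Type := seq (braid_letter n).

Definition letter_inv n (a : braid_letter n) : braid_letter n := (a.1, ~~ a.2).
Definition word_inv n (u : braid_word n) : braid_word n :=
  rev (map (@letter_inv n) u).

Inductive braid_eq (n : nat) : braid_word n -> braid_word n -> Prop :=
| braid_eq_refl u : braid_eq u u
| braid_eq_sym u v : braid_eq u v -> braid_eq v u
| braid_eq_trans u v w : braid_eq u v -> braid_eq v w -> braid_eq u w
| braid_eq_cat u u' v v' :
    braid_eq u u' -> braid_eq v v' -> braid_eq (u ++ v) (u' ++ v')
| braid_eq_cancel a : braid_eq [:: a; letter_inv a] [::]
| braid_eq_far (i j : 'I_n.-1) : (i.+1 < j)%N ->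
    braid_eq [:: (i, false); (j, false)] [:: (j, false); (i, false)]
| braid_eq_near (i j : 'I_n.-1) : j = i.+1 :> nat ->
    braid_eq [:: (i, false); (j, false); (i, false)]
             [:: (j, false); (i, false); (j, false)].

Definition braid_eqb n : rel (braid_word n) := fun u v => `[< braid_eq u v >].

Lemma braid_eqb_refl n : reflexive (@braid_eqb n).
Proof. by move=> u; apply/asboolP; exact: braid_eq_refl. Qed.

Lemma braid_eqb_sym n : symmetric (@braid_eqb n).
Proof. by move=> u v; apply/asboolP/asboolP; exact: braid_eq_sym. Qed.

Lemma braid_eqb_trans n : transitive (@braid_eqb n).
Proof.
move=> v u w /asboolP uv /asboolP vw; apply/asboolP; exact: braid_eq_trans vw.
Qed.

Canonical braid_equiv n := EquivRel (@braid_eqb n)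
  (@braid_eqb_refl n) (@braid_eqb_sym n) (@braid_eqb_trans n).

Definition braid (n : nat) : Type := {eq_quot (@braid_eqb n)}%qT.

HB.instance Definition _ n := Choice.on (braid n).
HB.instance Definition _ n := EqQuotient.on (braid n).
HB.instance Definition _ n :=
  Countable.copy (braid n) (can_type (@reprK _ (braid n))).

Definition braid_of_word n (u : braid_word n) : braid n := \pi_(braid n)%qT u.

Lemma braid_of_wordP n (u v : braid_word n) :
  braid_of_word u = braid_of_word v <-> braid_eq u v.
Proof.
split=> [h|h].
  by apply/asboolP; apply/(@eqmodP _ (braid_equiv n)).
by apply/(@eqmodP _ (braid_equiv n)); apply/asboolP.
Qed.

Lemma braid_of_word_repr n (b : braid n) : braid_of_word (repr b) = b.
Proof. exact: reprK. Qed.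

Lemma braid_eq_repr n (u : braid_word n) : braid_eq (repr (braid_of_word u)) u.
Proof. by apply/braid_of_wordP; rewrite braid_of_word_repr. Qed.

Definition braid_one n : braid n := braid_of_word [::].
Definition braid_mul n (x y : braid n) : braid n :=
  braid_of_word (repr x ++ repr y).
Definition braid_inv n (x : braid n) : braid n :=
  braid_of_word (word_inv (repr x)).

Lemma letter_invK n : involutive (@letter_inv n).
Proof. by case=> i b; rewrite /letter_inv negbK. Qed.

Lemma word_invK n : involutive (@word_inv n).
Proof.
by move=> u; rewrite /word_inv map_rev revK mapK //; exact: letter_invK.
Qed.

Lemma braid_eq_word_invr n (u : braid_word n) : braid_eq (u ++ word_inv u) [::].
Proof.
elim: u => [|a u IH]; first exact: braid_eq_refl.
have -> : (a :: u) ++ word_inv (a :: u) =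
    [:: a] ++ ((u ++ word_inv u) ++ [:: letter_inv a]).
  by rewrite /word_inv /= rev_cons -cats1 catA.
apply: (braid_eq_trans _ (braid_eq_cancel a)).
rewrite -[[:: a; _]]/([:: a] ++ ([::] ++ [:: letter_inv a])).
apply: braid_eq_cat; first exact: braid_eq_refl.
by apply: braid_eq_cat; [exact: IH|exact: braid_eq_refl].
Qed.

Lemma braid_eq_word_invl n (u : braid_word n) : braid_eq (word_inv u ++ u) [::].
Proof. by rewrite -{2}(word_invK u); exact: braid_eq_word_invr. Qed.

Lemma braid_mulA n : associative (@braid_mul n).
Proof.
move=> x y z; apply/braid_of_wordP.
apply: (@braid_eq_trans _ _ (repr x ++ (repr y ++ repr z))).
  by apply: braid_eq_cat; [exact: braid_eq_refl|exact: braid_eq_repr].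
rewrite catA; apply: braid_eq_sym.
by apply: braid_eq_cat; [exact: braid_eq_repr|exact: braid_eq_refl].
Qed.

Lemma braid_mul1 n : left_id (@braid_one n) (@braid_mul n).
Proof.
move=> x; rewrite -[RHS]braid_of_word_repr; apply/braid_of_wordP.
rewrite -[X in braid_eq _ X]cat0s.
by apply: braid_eq_cat; [exact: braid_eq_repr|exact: braid_eq_refl].
Qed.

Lemma braid_mulr1 n : right_id (@braid_one n) (@braid_mul n).
Proof.
move=> x; rewrite -[RHS]braid_of_word_repr; apply/braid_of_wordP.
rewrite -[X in braid_eq _ X]cats0.
by apply: braid_eq_cat; [exact: braid_eq_refl|exact: braid_eq_repr].
Qed.

Lemma braid_mulV n : left_inverse (@braid_one n) (@braid_inv n) (@braid_mul n).
Proof.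
move=> x; apply/braid_of_wordP; apply: (braid_eq_trans _ (braid_eq_word_invl (repr x))).
by apply: braid_eq_cat; [exact: braid_eq_repr|exact: braid_eq_refl].
Qed.

Lemma braid_mulrV n : right_inverse (@braid_one n) (@braid_inv n) (@braid_mul n).
Proof.
move=> x; apply/braid_of_wordP; apply: (braid_eq_trans _ (braid_eq_word_invr (repr x))).
by apply: braid_eq_cat; [exact: braid_eq_refl|exact: braid_eq_repr].
Qed.

HB.instance Definition _ n := isGroup.Build (braid n)
  (@braid_mulA n) (@braid_mul1 n) (@braid_mulr1 n) (@braid_mulV n)
  (@braid_mulrV n).

Definition braid_gen n (i : 'I_n.-1) : braid n := braid_of_word [:: (i, false)].

Lemma strand_proof n (i : 'I_n.-1) : (i < n)%N.
Proof. exact: leq_trans (ltn_ord i) (leq_pred n). Qed.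

Lemma strand_next_proof n (i : 'I_n.-1) : (i.+1 < n)%N.
Proof. by rewrite -ltn_predRL ltn_ord. Qed.

Definition letter_perm n (a : braid_letter n) : 'S_n :=
  tperm (Ordinal (strand_proof a.1)) (Ordinal (strand_next_proof a.1)).

Definition word_perm n (u : braid_word n) : 'S_n :=
  (\prod_(a <- u) letter_perm a)%g.

Definition braid_perm n (x : braid n) : 'S_n := word_perm (repr x).

Lemma word_perm_cat n (u v : braid_word n) :
  word_perm (u ++ v) = (word_perm u * word_perm v)%g.
Proof. by rewrite /word_perm big_cat. Qed.

Lemma tperm_braid (T : finType) (x y z : T) : x != y -> y != z -> x != z ->
  (tperm x y * (tperm y z * tperm x y) = tperm y z * (tperm x y * tperm y z))%g.
Proof.
move=> xy yz xz.
have -> : (tperm x y * (tperm y z * tperm x y) = tperm y z ^ tperm x y)%g.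
  by rewrite /conjg tpermV.
have -> : (tperm y z * (tperm x y * tperm y z) = tperm x y ^ tperm y z)%g.
  by rewrite /conjg tpermV.
by rewrite !tpermJ tpermR tpermL !tpermD // eq_sym.
Qed.

Lemma word_perm_eq n (u v : braid_word n) :
  braid_eq u v -> word_perm u = word_perm v.
Proof.
elim=> {u v} //.
- by move=> u v w _ -> _ ->.
- by move=> u u' v v' _ IHu _ IHv; rewrite !word_perm_cat IHu IHv.
- by move=> a; rewrite /word_perm !big_cons !big_nil mulg1 tperm2.
- move=> i j ij; rewrite /word_perm !big_cons !big_nil !mulg1 /letter_perm /=.
  by rewrite conjgC tpermJ !tpermD // -val_eqE /=; lia.
- move=> i j ij; rewrite /word_perm !big_cons !big_nil !mulg1 /letter_perm /=.
  have -> : Ordinal (strand_proof j) = Ordinal (strand_next_proof i).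
    exact: val_inj.
  by rewrite tperm_braid // -val_eqE /=; lia.
Qed.

Lemma braid_permM n : {morph @braid_perm n : x y / (x * y)%g}.
Proof.
by move=> x y; rewrite /braid_perm -word_perm_cat; apply/word_perm_eq/braid_eq_repr.
Qed.

Lemma braid_perm1 n : braid_perm (1%g : braid n) = 1%g.
Proof.
by rewrite /braid_perm (word_perm_eq (braid_eq_repr _)) /word_perm big_nil.
Qed.

HB.instance Definition _ n := isUMagmaMorphism.Build (braid n) 'S_n
  (@braid_perm n) (@braid_perm1 n, @braid_permM n).

Lemma braid_perm_gen n (i : 'I_n.-1) :
  braid_perm (braid_gen i) =
  tperm (Ordinal (strand_proof i)) (Ordinal (strand_next_proof i)).
Proof.
by rewrite /braid_perm (word_perm_eq (braid_eq_repr _)) /word_perm big_seq1.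
Qed.

HB.instance Definition _ n := isPointed.Build (braid n) (braid_one n).

(* The braid group is countable, so every probability distribution on it lives
   on the discrete sigma-algebra and is determined by its point masses. *)
HB.instance Definition _ n := @isMeasurable.Build default_measure_display
  (braid n) discrete_measurable discrete_measurable0
  discrete_measurableC discrete_measurableU.

(* The process [omega] is the Markov chain on the braid group that starts at
   the identity and has transition probability (x, y) |-> mu (x y^-1). The
   Markov property is written as a product, which avoids conditioning on null
   events. *)
Definition random_walk (R : realType) (n : nat) (mu : probability (braid n) R)
    (d : measure_display) (Omega : measurableType d)
    (P : probability Omega R) (omega : nat -> {RV P >-> braid n}) : Prop :=
  P [set w | omega 0%N w = 1%g] = 1%E /\
  forall (k : nat) (x : nat -> braid n),
    P [set w | forall i, (i <= k.+1)%N -> omega i w = x i] =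
    (P [set w | forall i, (i <= k)%N -> omega i w = x i] *
     mu [set (x k * (x k.+1)^-1)%g])%E.

Definition induces_uniform (R : realType) (n : nat)
    (d : measure_display) (Omega : measurableType d)
    (P : probability Omega R) (omega : nat -> {RV P >-> braid n}) : Prop :=
  forall s : 'S_n,
    P [set w | braid_perm (omega k w) = s] @[k --> \oo] -->
    ((n`!%:R : R)^-1)%:E.

Definition is_partition (n : nat) (lam : seq nat) : bool :=
  [&& sorted geq lam, 0%N \notin lam & sumn lam == n].

(* Cycles are orbits, so fixed letters count as cycles of length 1. *)
Definition strings_partition (n : nat) (x : braid n) : seq nat :=
  sort geq [seq #|C| | C : {set 'I_n} <- enum (porbits (braid_perm x))].

Lemma strings_partitionP n (x : braid n) : is_partition n (strings_partition x).
Proof.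
rewrite /is_partition /strings_partition; apply/and3P; split.
- by apply: sort_sorted => a b; exact: leq_total.
- rewrite mem_sort; apply/mapP => -[C]; rewrite mem_enum => /imsetP[y _ ->].
  by move/esym/eqP; rewrite (cardD1 y) porbit_id.
- rewrite (perm_sumn (permEl (perm_sort _ _))) sumnE big_map big_enum.
  rewrite -[X in _ == X]card_ord -cardsT eq_sym; apply/eqP/card_partition.
  rewrite [porbits _](_ : _ = orbit 'P <[braid_perm x]> @: [set: 'I_n]%SET).
  by apply/orbit_partition/actsP => a _ y; rewrite !inE.
  by apply/setP => C; apply/imsetP/imsetP => -[y _ ->]; exists y; rewrite // porbitE.
Qed.

Definition most_expected_partition (R : realType) (n : nat)
    (d : measure_display) (Omega : measurableType d)
    (P : probability Omega R) (omega : nat -> {RV P >-> braid n})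
    (lam : seq nat) : Prop :=
  is_partition n lam /\
  \forall k \near \oo, forall nu : seq nat, is_partition n nu ->
    (P [set w | strings_partition (omega k w) = nu] <=
     P [set w | strings_partition (omega k w) = lam])%E.

(* Main.v *)
Require Import Defs.
From HB Require Import structures.
From mathcomp Require Import all_boot all_order all_algebra all_fingroup.
From mathcomp Require Import zify.
From mathcomp Require Import all_classical all_reals all_analysis.

Set Implicit Arguments.
Unset Strict Implicit.
Unset Printing Implicit Defensive.

Import Order.TTheory GRing.Theory Num.Theory.

(** The law of the permutation of the random braid tends to the uniform law on
the symmetric group, so the probability that the partition of the strings is
[nu] tends to [N nu / n!], where [N nu] is the number of permutations of cycle
type [nu] ([cvg_strings_partition]). There are finitely many cycle types, so it
is enough that [N] has a strict maximum at [(n-1, 1)]: a strict inequality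
between limits holds between the probabilities at all large times
([near_strings_partition_lt]), and this settles both directions.

Cauchy's formula [card_cycle_type] says [N nu * z nu = n!], where
[z nu = prod_i i^(m_i) m_i!] and [m_i] is the multiplicity of [i] in [nu]. To
prove it, write each permutation of type [nu] as a word that lists its cycles
one after the other, with lengths in the order of [nu]. Choosing the cycle of
each length and its first letter gives [z nu] words for each permutation
([size_cycle_words]). Every word with all letters exactly once is obtained from
exactly one permutation: cutting the word at the places given by [nu] recovers
the cycles ([cycle_words_inj], [cycles_perm], [flatten_cycle_words]).

It remains to minimise [z]. For [n >= 3] one has [z (n-1, 1) = n-1], and an
induction on the parts gives [z nu >= n] for all other partitions
([sumn_le_zfactor]): a product of integers that are at least 2 is at least their
sum, and several parts equal to 1 are compensated by the factorial of their
number. A single part equal to 1 is compensated as soon as there are two more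
parts, and this leaves only [(n-1, 1)]. *)

(** * Cycle types and words of cycles *)

Section CycleType.
Variable T : finType.
Implicit Types (s t : {perm T}) (Q : {set {set T}}) (nu : seq nat).

Definition cycle_type s : seq nat :=
  sort geq [seq #|C| | C : {set T} <- enum (porbits s)].

(** The cycle of [s] through [y], written from [y]. *)
Definition cycle_word s y : seq T := traject s y #|porbit s y|.

(** The words that list the cycles whose supports form the set [Q], in an order
for which the sequence of lengths is [nu]. Words are listed rather than collected
in a set so that the choices can be counted by the size of a list without
repetition. *)
Fixpoint cycle_words s nu Q : seq (seq T) :=
  if nu is i :: nu' then
    [seq cycle_word s y ++ u |
       y <- enum [set y | (porbit s y \in Q) && (#|porbit s y| == i)],
       u <- cycle_words s nu' (Q :\ porbit s y)]
  else [:: [::]].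

Lemma cycle_word_cons s y : cycle_word s y = y :: behead (cycle_word s y).
Proof.
by rewrite /cycle_word; case: #|_| (card_porbit_neq0 s y).
Qed.

Lemma perm_enum_setD1 Q C : C \in Q -> perm_eq (enum Q) (C :: enum (Q :\ C)).
Proof.
move=> QC; apply: uniq_perm; rewrite /= ?enum_uniq ?mem_enum ?setD11 //.
by move=> D; rewrite inE !mem_enum !inE; case: eqP => // ->.
Qed.

Lemma perm_sizes_setD1 nu Q C : C \in Q ->
  perm_eq [seq #|D| | D : {set T} <- enum Q] (#|C| :: nu) =
  perm_eq [seq #|D| | D : {set T} <- enum (Q :\ C)] nu.
Proof.
move=> QC; rewrite (permPl (perm_map _ (perm_enum_setD1 QC))) /=.
by rewrite perm_cons.
Qed.

Lemma porbit_mem_porbits s Q C y : Q \subset porbits s -> C \in Q ->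
  (y \in C) = (porbit s y == C).
Proof.
by move=> /fintype.subsetP QP /QP/imsetP[x _ ->]; rewrite eq_porbit_mem porbit_sym.
Qed.

(** Each cycle of length [i] can be started at any of its [i] letters. *)
Lemma card_cycle_starts s Q i : Q \subset porbits s ->
  #|[set y | (porbit s y \in Q) && (#|porbit s y| == i)]| =
  i * count_mem i [seq #|C| | C : {set T} <- enum Q].
Proof.
move=> QP; rewrite -sum1_card.
rewrite (partition_big (porbit s) [pred C in Q | #|C| == i]) => [|y]; last first.
  by rewrite inE.
rewrite (eq_bigr (fun=> i)) => [|C /andP[QC /eqP Ci]].
  rewrite sum_nat_const mulnC count_map -size_filter cardE /enum_mem.
  rewrite -filter_predI; congr (_ * size _); apply: eq_filter => C /=.
  by rewrite andbC.
rewrite -Ci -sum1_card; apply: eq_bigl => y.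
rewrite inE (porbit_mem_porbits y QP QC) -andbA.
by case: (porbit s y =P C) => [->|]; rewrite ?andbF // QC sum1_card eqxx.
Qed.

(** This is [prod_i i^(m_i) m_i!], with [m_i] the multiplicity of [i]: the parts
equal to [i] contribute the factors [1], [2], ..., [m_i] from the last one to the
first one. *)
Fixpoint zfactor nu : nat :=
  if nu is i :: nu' then i * (count_mem i nu').+1 * zfactor nu' else 1.

(** If the first length is [i], the first letter can be any of the [i * m_i]
letters on cycles of length [i]; the rest is the same problem without that cycle
and that part. *)
Lemma size_cycle_words s nu Q : Q \subset porbits s ->
  perm_eq [seq #|C| | C : {set T} <- enum Q] nu ->
  size (cycle_words s nu Q) = zfactor nu.
Proof.
elim: nu Q => // i nu IH Q QP Qnu; rewrite size_allpairs_dep.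
rewrite (eq_in_map _ (fun=> zfactor nu) _).1 => [|y]; last first.
  rewrite mem_enum inE => /andP[Qy /eqP yi]; rewrite IH //.
    exact: fintype.subset_trans (subD1set _ _) QP.
  by rewrite -(perm_sizes_setD1 _ Qy) yi.
rewrite sumnE big_map big_const_seq count_predT iter_addn_0 -cardE.
by rewrite card_cycle_starts // (seq.permP Qnu) /= eqxx add1n mulnC.
Qed.

Lemma size_cycle_word s y : size (cycle_word s y) = #|porbit s y|.
Proof. exact: size_traject. Qed.

Lemma cycle_words_uniq s nu Q : uniq (cycle_words s nu Q).
Proof.
elim: nu Q => //= i nu IH Q; apply: allpairs_uniq_dep => [|y _|].
- exact: enum_uniq.
- exact: IH.
move=> [y u] [y' u'] _ _ /= /eqP.
rewrite cycle_word_cons (cycle_word_cons s y') !cat_cons eqseq_cons.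
by case: eqP => //= <-; rewrite eqseq_cat ?eqxx //= => /eqP ->.
Qed.

(** The cycles are disjoint, so no letter is repeated. For [Q = porbits s] the
word is an enumeration of the whole type. *)
Lemma cycle_words_mem s nu Q u : Q \subset porbits s ->
  perm_eq [seq #|C| | C : {set T} <- enum Q] nu ->
  u \in cycle_words s nu Q -> uniq u /\ u =i [pred y | porbit s y \in Q].
Proof.
elim: nu Q u => [|i nu IH] Q u QP Qnu /=.
  rewrite inE => /eqP->; split=> // y; rewrite !inE; apply/esym/negP => Qy.
  by move: (perm_size Qnu); rewrite (perm_size (perm_map _ (perm_enum_setD1 Qy))).
case/allpairsPdep => y [v [yQ v_in ->]].
move: yQ; rewrite mem_enum inE => /andP[Qy /eqP yi].
have [] := IH _ _ _ _ v_in.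
- exact: fintype.subset_trans (subD1set _ _) QP.
- by rewrite -(perm_sizes_setD1 _ Qy) yi.
move=> Uv mv; split=> [|x].
  rewrite cat_uniq uniq_traject_porbit Uv andbT; apply/hasPn => x.
  rewrite mv !inE => /andP[xy _].
  by rewrite -[~~ _]/(x \notin cycle_word s y) -porbit_traject -eq_porbit_mem.
rewrite mem_cat -porbit_traject mv !inE -eq_porbit_mem.
by case: eqP => [->|].
Qed.

(** Both iterations return to [y] after the common length of the two words, so
they also agree at the last letter. *)
Lemma cycle_word_inj s t y : cycle_word s y = cycle_word t y ->
  {in cycle_word s y, s =1 t}.
Proof.
move=> E x /(nthP y)[k]; rewrite size_cycle_word => ks <-.
have Et: #|porbit t y| = #|porbit s y| by rewrite -!size_cycle_word E.
have iE j : j <= #|porbit s y| -> iter j s y = iter j t y.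
  rewrite leq_eqVlt => /predU1P[->|js].
    by rewrite iter_porbit -Et iter_porbit.
  by have := congr1 (nth y ^~ j) E; rewrite !nth_traject ?Et.
rewrite nth_traject // -iterS iE // iterS; congr (t _).
by rewrite iE // ltnW.
Qed.

(** The lengths in [nu] determine where to cut the word into cycles, so a word
has a single source once [nu] is fixed. *)
Lemma cycle_words_inj s t nu Q Q' u :
  u \in cycle_words s nu Q -> u \in cycle_words t nu Q' -> {in u, s =1 t}.
Proof.
elim: nu Q Q' u => [|i nu IH] Q Q' u /=; first by rewrite inE => /eqP->.
case/allpairsPdep => y [v [yQ vQ ->]] /allpairsPdep[y' [v' [yQ' vQ']]] E.
move: yQ yQ'; rewrite !mem_enum !inE => /andP[_ /eqP yi] /andP[_ /eqP yi'].
have /eqP := E; rewrite eqseq_cat ?size_cycle_word ?yi ?yi' // => /andP[/eqP Ey /eqP Ev].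
have yy' : y = y'.
  by move: Ey; rewrite cycle_word_cons (cycle_word_cons t) => -[].
subst v' y' => x; rewrite mem_cat => /orP[]; first exact: cycle_word_inj.
exact: IH vQ vQ' _.
Qed.

(** * The permutation with given cycles *)

Lemma fcycle_cycle_word s y b : uniq (y :: b) -> fcycle s (y :: b) ->
  cycle_word s y = y :: b.
Proof.
move=> Ub cb; have yb : y \in y :: b by rewrite mem_head.
have Eb : porbit s y =i fconnect s y.
  move=> x; apply/porbitP/idP => [[k ->]|/iter_findex <-].
    by rewrite permX; exact: fconnect_iter.
  by exists (findex s y x); rewrite permX.
rewrite /cycle_word (eq_card Eb) -/(fingraph.order s y) -/(fingraph.orbit s y).
by rewrite (fingraph.orbitE cb Ub) //= eqxx rot0.
Qed.

Lemma uniq_flatten_mem (bs : seq (seq T)) b :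
  uniq (flatten bs) -> b \in bs -> uniq b.
Proof.
elim: bs => //= c bs IH; rewrite cat_uniq inE => /and3P[Uc _ Ubs].
by case/predU1P=> [->|]; last exact: IH.
Qed.

(** The default value, an empty block, makes [next (block bs x)] fix the letters outside
[flatten bs]. *)
Definition block (bs : seq (seq T)) x :=
  nth [::] bs (find (fun b : seq T => x \in b) bs).

Lemma block_mem bs b x :
  uniq (flatten bs) -> b \in bs -> x \in b -> block bs x = b.
Proof.
rewrite /block; elim: bs => //= c bs IH.
rewrite cat_uniq inE => /and3P[_ /hasPn cbs Ubs].
case/predU1P=> [-> -> //|bbs xb].
have /negPf -> : x \notin c by apply: cbs; apply/flattenP; exists b.
exact: IH.
Qed.

(** The permutation moves each letter to the next one in its own block, in cyclic
order. A letter and its image lie in the same block, so [prev] in that block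
inverts this map. *)
Lemma cycles_perm (bs : seq (seq T)) : uniq (flatten bs) ->
  exists s : {perm T}, all (fcycle s) bs.
Proof.
move=> Ubs; have blockE b x := @block_mem bs b x Ubs.
have blockP x : block bs x \in bs \/ block bs x = [::].
  rewrite /block; set k := find _ _.
  by case: (ltnP k (size bs)) => h; [left; exact: mem_nth|right; exact: nth_default].
have Ublock x : uniq (block bs x).
  by case: (blockP x) => [|-> //]; exact: uniq_flatten_mem.
have block_next x : block bs (next (block bs x) x) = block bs x.
  case: (boolP (x \in block bs x)) => xb; last by rewrite next_nth (negPf xb).
  case: (blockP x) => [bs_x|E]; last by rewrite E in xb.
  by rewrite (blockE _ _ bs_x) // mem_next.
have next_inj : injective (fun x => next (block bs x) x).
  move=> x y /= E; have Exy : block bs x = block bs y by rewrite -block_next E block_next.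
  by rewrite -(prev_next (Ublock x) x) E Exy prev_next.
exists (perm next_inj); apply/allP => b bbs.
have Ub := uniq_flatten_mem Ubs bbs.
apply: (@sub_in_cycle _ (mem b) (frel (next b))) => [x y xb _ /eqP <- /=||].
- by rewrite permE (blockE b).
- by apply/allP.
- exact: cycle_next.
Qed.

(** Any way to cut a word into cycles of [s] is among the choices made by
[cycle_words], so the count of [size_cycle_words] misses no word. *)
Lemma flatten_cycle_words s (bs : seq (seq T)) :
  [::] \notin bs -> uniq (flatten bs) -> all (fcycle s) bs ->
  let Q := porbit s @: [set x in flatten bs] in
  flatten bs \in cycle_words s (shape bs) Q /\
  perm_eq [seq #|C| | C : {set T} <- enum Q] (shape bs).
Proof.
elim: bs => [|b bs IH] /=.
  rewrite inE => _ _ _; split=> //.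
  rewrite (_ : _ @: _ = finset.set0) ?enum_set0 //.
  by apply/eqP; rewrite imset_eq0; apply/eqP/finset.setP => x; rewrite !inE.
case: b => // y b; rewrite inE /= => nbs.
rewrite -[_ :: b ++ _]/((y :: b) ++ flatten bs) => U /andP[cb cbs].
have := U; rewrite -[_ && _]/(uniq ((y :: b) ++ flatten bs)) cat_uniq.
move=> /and3P[Ub /hasPn bbs Ubs].
have [] := IH nbs Ubs cbs; set Q := porbit s @: _; set Q' := porbit s @: _.
move=> IH1 IH2.
have Eb := fcycle_cycle_word Ub cb.
have yE x : (porbit s x == porbit s y) = (x \in y :: b).
  by rewrite eq_porbit_mem porbit_traject -/(cycle_word s y) Eb.
have Qy : porbit s y \in Q'.
  by apply: imset_f; rewrite inE mem_head.
have QE : Q' :\ porbit s y = Q.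
  apply/setP => C; rewrite !inE; apply/andP/imsetP.
    move=> [Cy /imsetP[x]]; rewrite inE mem_cat => /orP[xb|xbs] EC; subst C.
      by rewrite yE xb in Cy.
    by exists x; rewrite ?inE.
  move=> [x]; rewrite inE => xbs ->; rewrite yE bbs //; split=> //.
  by apply: imset_f; rewrite inE mem_cat xbs orbT.
have sz : #|porbit s y| = (size b).+1 by rewrite -size_cycle_word Eb.
split; last by rewrite -sz (perm_sizes_setD1 _ Qy) QE.
apply/allpairsPdep; exists y, (flatten bs); rewrite mem_enum inE Qy sz eqxx QE Eb.
by split.
Qed.

(** * Counting permutations by cycle type *)

(** Cauchy's formula, by double counting: the orderings of [T] are the words of
the permutations of type [nu], without repetition, and each such permutation has
[zfactor nu] words. *)
Lemma card_cycle_type nu :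
  sorted geq nu -> 0 \notin nu -> sumn nu = #|T| ->
  #|[set s | cycle_type s == nu]| * zfactor nu = (#|T|)`!.
Proof.
move=> nu_sorted nu0 nuT; pose S := [set s | cycle_type s == nu].
have typeP s : (s \in S) = perm_eq [seq #|C| | C : {set T} <- enum (porbits s)] nu.
  have geq_trans : transitive geq by move=> y x z /= yx zy; exact: leq_trans yx.
  rewrite inE; apply/eqP/idP => [<-|E]; first by rewrite perm_sym perm_sort.
  rewrite /cycle_type -(sorted_sort geq_trans nu_sorted).
  apply/perm_sortP => // x y; first exact: leq_total.
  by rewrite andbC -eqn_leq => /eqP.
pose W := [seq u | s <- enum S, u <- cycle_words s nu (porbits s)].
have WP : perm_eq W (permutations (enum T)).
  apply: uniq_perm (permutations_uniq _) _ => [|u].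
    apply: allpairs_uniq_dep => [|s _|]; [exact: enum_uniq|exact: cycle_words_uniq|].
    move=> _ _ /allpairsPdep[s [u [sS us ->]]] /allpairsPdep[t [v [tS vt ->]]] /= E.
    subst v; suff -> : s = t by [].
    apply/permP => x; apply: (cycle_words_inj us vt).
    move: sS; rewrite mem_enum typeP => sS.
    by rewrite (cycle_words_mem (subxx _) sS us).2 inE imset_f.
  rewrite mem_permutations; apply/allpairsPdep/idP.
    move=> [s [v [sS vs ->]]]; move: sS; rewrite mem_enum typeP => sS.
    have [Uv vE] := cycle_words_mem (subxx _) sS vs.
    by apply: uniq_perm (enum_uniq _) _ => // x; rewrite vE mem_enum !inE imset_f.
  move=> u_enum; have szu : size u = sumn nu by rewrite (perm_size u_enum) -cardE nuT.
  pose bs := reshape nu u.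
  have fbs : flatten bs = u by rewrite reshapeKr // szu.
  have sbs : shape bs = nu by rewrite reshapeKl // szu.
  have Ubs : uniq (flatten bs) by rewrite fbs (perm_uniq u_enum) enum_uniq.
  have nbs : [::] \notin bs.
    by apply: contra nu0 => /(map_f size); rewrite -/(shape bs) sbs.
  have [s cs] := cycles_perm Ubs.
  have [] := flatten_cycle_words nbs Ubs cs.
  rewrite (_ : _ @: _ = porbits s) => [uW sS|]; last first.
    apply/setP => C; apply/imsetP/imsetP => -[x _ ->]; exists x => //.
    by rewrite inE fbs (perm_mem u_enum) mem_enum.
  rewrite fbs sbs in uW sS.
  by exists s, u; rewrite mem_enum typeP.
rewrite cardT -(size_permutations (enum_uniq T)) -(perm_size WP) size_allpairs_dep.
rewrite (eq_in_map _ (fun=> zfactor nu) _).1 => [|s]; last first.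
  by rewrite mem_enum typeP => sS; rewrite size_cycle_words.
by rewrite sumnE big_map big_const_seq count_predT iter_addn_0 -cardE mulnC.
Qed.

Lemma zfactor_gt0 nu : 0 \notin nu -> 0 < zfactor nu.
Proof.
elim: nu => //= i nu IH; rewrite inE eq_sym negb_or => /andP[i0 /IH z0].
by rewrite !muln_gt0 z0 lt0n i0.
Qed.

(** Adding a part [i >= 2] multiplies the factor by at least [i], and
[i * N >= i + N] as soon as the sum [N] of the other parts is at least 2. The
exceptional shape [(j, 1)] misses its sum by one only, and this is made up for by
any part added in front: if the part differs from [j] it is at least 3, and if
it equals [j] the multiplicity doubles the factor. *)
Lemma sumn_le_zfactor nu : sorted geq nu -> 0 \notin nu ->
  (forall i, 1 < i -> nu <> [:: i; 1]) -> sumn nu <= zfactor nu.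
Proof.
elim: nu => //= i nu IH nu_sorted; rewrite inE eq_sym negb_or => /andP[i0 nu0] nuX.
have z_gt0 := zfactor_gt0 nu0.
have nu_le : all (geq i) nu.
  apply: order_path_min nu_sorted => y x z /= yx zy; exact: leq_trans yx.
have {}IH := IH (path_sorted nu_sorted) nu0.
case: (ltngtP i 1) => [|i_gt1|i1]; first by lia.
(* The tail may itself be of the exceptional shape. *)
- have [[j j_gt1 E]|nuX'] : (exists2 j, 1 < j & nu = [:: j; 1]) \/
      forall j, 1 < j -> nu <> [:: j; 1].
    case: (boolP ((size nu == 2) && (1 < nth 0 nu 0) && (nth 0 nu 1 == 1))) => H.
      left; move: H.
      case: nu {nu_sorted nu0 nuX z_gt0 nu_le IH} => [|j [|k [|]]] //=.
      by move=> /andP[j1 /eqP->]; exists j.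
    by right => j j1 E; rewrite E /= j1 eqxx in H.
  + move: nu_le; rewrite E /= => /andP[ji _].
    case: (ltngtP j i) ji => // [ji|->] _; rewrite ?eqxx; nia.
  + have {}IH := IH nuX'.
    case: nu {nu_sorted nu_le nuX'} nu0 nuX IH z_gt0 => [|j nu] nu0 nuX IH z_gt0.
      by rewrite /=; lia.
    have s2 : 1 < sumn (j :: nu).
      case: j nu nu0 nuX {IH z_gt0} => [|[|j]] // [|k nu] //=.
        by move=> _ /(_ _ i_gt1).
      by rewrite !inE; lia.
    nia.
(* All parts are 1 here, so the factor is a factorial. *)
- subst i; have E : sumn nu = count_mem 1 nu.
    elim: nu nu0 nu_le {nu_sorted nuX z_gt0 IH} => //= j nu IH.
    by rewrite inE negb_or => /andP[j0 /IH{}IH] /andP[j1 /IH->]; lia.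
  by rewrite -E mul1n add1n leq_pmulr.
Qed.

(** In Cauchy's formula the product is the same for both types, and the factor is
[n.-1] for [(n-1, 1)] and at least [n] for [nu]. *)
Lemma card_cycle_type_lt n nu : 3 <= n -> #|T| = n ->
  sorted geq nu -> 0 \notin nu -> sumn nu = n -> nu <> [:: n.-1; 1] ->
  #|[set s : {perm T} | cycle_type s == nu]| <
  #|[set s : {perm T} | cycle_type s == [:: n.-1; 1]]|.
Proof.
move=> n3 Tn nu_sorted nu0 nun nuX.
have z_ge : n <= zfactor nu.
  rewrite -nun; apply: sumn_le_zfactor => // i _ E; apply: nuX.
  by rewrite -nun E /=; congr [:: _; _]; lia.
have := @card_cycle_type nu nu_sorted nu0; rewrite Tn => /(_ nun).
have /= := @card_cycle_type [:: n.-1; 1]; rewrite Tn !inE.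
have -> : (1 == n.-1) = false by lia.
move=> /(_ _ _ _)/wrap[]; rewrite ?andbT; [lia|lia|lia|].
rewrite !muln1 => Eb Ea; have := fact_gt0 n; rewrite -Ea muln_gt0 => /andP[a0 _].
have n1_gt0 : 0 < n.-1 by lia.
by rewrite -(ltn_pmul2r n1_gt0) Eb -Ea ltn_pmul2l //; lia.
Qed.

End CycleType.

(** * Limit probabilities of the partitions of the strings *)

Section Limits.
Local Open Scope classical_set_scope.
Local Open Scope ring_scope.
Variable R : realType.

Lemma cvg_lte_near (I : Type) (F : set_system I) (FF : Filter F)
    (f g : I -> \bar R) (a b : R) :
  f i @[i --> F] --> a%:E -> g i @[i --> F] --> b%:E -> a < b ->
  \forall i \near F, (f i < g i)%E.
Proof.
move=> fa gb ab.
have [am mb] := midf_lt ab; have [ffin fR] := (fine_cvgP _ _).1 fa.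
have [gfin gR] := (fine_cvgP _ _).1 gb.
have fm := cvgr_lt _ fR _ am; have mg := cvgr_gt _ gR _ mb.
have /(_ FF FF FF) H := filterI (filterI ffin gfin) (filterI (fm FF) (mg FF)).
apply: (@filterS _ F FF _ _ _ H) => i [[fi gi] [/= fim gim]].
by rewrite -(fineK fi) -(fineK gi) lte_fin (lt_trans fim gim).
Qed.

Variables (n : nat) (d : measure_display) (Omega : measurableType d).
Variables (P : probability Omega R) (omega : nat -> {RV P >-> braid n}).

(** By definition [strings_partition x] is the cycle type of [braid_perm x], so
the event is a finite disjoint union over the permutations of type [nu]. *)
Lemma prob_strings_partition k nu :
  P [set w | strings_partition (omega k w) = nu] =
  (\sum_(s <- enum [set s : 'S_n | cycle_type s == nu]%SET)
     P [set w | braid_perm (omega k w) = s])%E.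
Proof.
set S := [set s | _]%SET.
have -> : [set w | strings_partition (omega k w) = nu] =
    \bigcup_(s in [set` enum S]) [set w | braid_perm (omega k w) = s].
  apply/seteqP; split=> w /=.
    move=> E; exists (braid_perm (omega k w)) => //=.
    by rewrite mem_enum inE; apply/eqP.
  by move=> [s /=]; rewrite mem_enum inE => /eqP <- <-.
rewrite measure_fin_bigcup //.
- by rewrite -fsbig_seq ?enum_uniq.
- by move=> s t _ _ [w [/= <- <-]].
- move=> s _.
  by apply: (measurable_funPTI (omega k) (Y := [set x | braid_perm x = s])).
Qed.

Hypothesis hunif : induces_uniform omega.

Lemma cvg_strings_partition nu :
  P [set w | strings_partition (omega k w) = nu] @[k --> \oo] -->
  (#|[set s : 'S_n | cycle_type s == nu]%SET|%:R / n`!%:R : R)%:E.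
Proof.
set S := [set s | _]%SET.
have -> : (#|S|%:R / n`!%:R : R)%:E = (\sum_(s <- enum S) (n`!%:R^-1)%:E)%E.
  by rewrite sumEFin big_const_seq count_predT -cardE iter_addr_0 mulr_natl.
under eq_fun do rewrite prob_strings_partition.
by apply: cvg_nnesum => s _; [exact: nearW|exact: hunif].
Qed.

Lemma near_strings_partition_lt nu nu' :
  (#|[set s : 'S_n | cycle_type s == nu]%SET| <
   #|[set s : 'S_n | cycle_type s == nu']%SET|)%N ->
  \forall k \near \oo, (P [set w | strings_partition (omega k w) = nu] <
    P [set w | strings_partition (omega k w) = nu'])%E.
Proof.
move=> lt_nu; apply: cvg_lte_near; [exact: cvg_strings_partition..|].
by rewrite ltr_pM2r ?ltr_nat // invr_gt0 ltr0n fact_gt0.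
Qed.

Lemma most_expected_partitionP (lam : seq nat) : (3 <= n)%N ->
  most_expected_partition omega lam <-> lam = [:: n.-1; 1%N].
Proof.
move=> n3.
have target_partition : is_partition n [:: n.-1; 1%N].
  by rewrite /is_partition /= !inE; lia.
have lt_target nu : is_partition n nu -> nu <> [:: n.-1; 1%N] ->
    \forall k \near \oo, (P [set w | strings_partition (omega k w) = nu] <
      P [set w | strings_partition (omega k w) = [:: n.-1; 1%N]])%E.
  move=> /and3P[nu_sorted nu0 /eqP nu_n] nuX.
  apply: near_strings_partition_lt; apply: card_cycle_type_lt => //.
  exact: card_ord.
split=> [[lamP lam_max]|->].
  apply: contrapT => lamX.
  have [k [lt_k max_k]] := filter_ex (filterI (lt_target lam lamP lamX) lam_max).
  by have := lt_le_trans lt_k (max_k _ target_partition); rewrite ltxx.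
split=> //.
(* Quantifying over permutations makes the family of conditions finite. *)
have: \forall k \near \oo, forall s : 'S_n, is_partition n (cycle_type s) ->
    (P [set w | strings_partition (omega k w) = cycle_type s] <=
     P [set w | strings_partition (omega k w) = [:: n.-1; 1%N]])%E.
  apply: filter_forall => s.
  case: (eqVneq (cycle_type s) [:: n.-1; 1%N]) => [->|/eqP sX]; first exact: nearW.
  have [sP|/negP sP] := boolP (is_partition n (cycle_type s)); last exact: nearW.
  by apply: filterS (lt_target _ sP sX) => k /ltW.
apply: filterS => k max_k nu nuP.
(* A partition that is not a cycle type has probability 0. *)
have [[s Es]|nuX] := pselect (exists s : 'S_n, cycle_type s = nu).
  by rewrite -Es in nuP *; exact: max_k.
rewrite [X in P X](_ : _ = set0) ?measure0 ?measure_ge0 //.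
by apply/seteqP; split=> // w /= E; apply: nuX; exists (braid_perm (omega k w)).
Qed.

End Limits.

Theorem theorem1p2 (R : realType) (n : nat) (hn : (3 <= n)%N)
    (mu : probability (braid n) R)
    (d : measure_display) (Omega : measurableType d)
    (P : probability Omega R) (omega : nat -> {RV P >-> braid n})
    (homega : random_walk mu omega)
    (hunif : induces_uniform omega)
    (lam : seq nat) :
  most_expected_partition omega lam <-> lam = [:: n.-1; 1%N].
Proof. exact: most_expected_partitionP. Qed.
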